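(* For every $n\in\mathbb N$, in the Euclidean space $X=\mathbb R^n$ (endowed with the coarse structure generated by the Euclidean metric) the ideal $\mathcal S(X)$ of small subsets of $X$ coincides with the ideal $\mathcal D_<(X)=\{A\subset X:\operatorname{asdim}(A)<\operatorname{asdim}(X)\}$.
   Context: A coarse space is a pair $(X,\mathcal E)$ where $\mathcal E$ is a family of subsets of $X\times X$ (entourages) such that: each $\varepsilon\in\mathcal E$ contains the diagonal $\Delta_X$ and satisfies $\varepsilon=\varepsilon^{-1}$; for any $\varepsilon,\delta\in\mathcal E$ some $\eta\in\mathcal E$ contains $\delta\circ\varepsilon=\{(x,z):\exists y\,(x,y)\in\varepsilon,(y,z)\in\delta\}$; and any $\delta$ with $\Delta_X\subset\delta=\delta^{-1}\subset\varepsilon$ for some $\varepsilon\in\mathcal E$ belongs to $\mathcal E$. A metric $d$ on $X$ generates the coarse structure with base $\{\{(x,y):d(x,y)<r\}:0\le r<\infty\}$. Each $A\subset X$ carries the subspace coarse structure $\{\varepsilon\cap A^2:\varepsilon\in\mathcal E\}$. For $x\in X$, $A\subset X$: $B(x,\varepsilon)=\{y:(x,y)\in\varepsilon\}$, $B(A,\varepsilon)=\bigcup_{a\in A}B(a,\varepsilon)$. For a family $\mathcal U$ of subsets, $\operatorname{mesh}(\mathcal U)=\bigcup_{U\in\mathcal U}U\times U$. The asymptotic dimension $\operatorname{asdim}(X)$ is the least $n\in\omega$ such that for every $\varepsilon\in\mathcal E$ there is a cover $\mathcal U$ of $X$ with $\operatorname{mesh}(\mathcal U)\subset\delta$ for some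 $\delta\in\mathcal E$ and each ball $B(x,\varepsilon)$ meeting at most $n+1$ members of $\mathcal U$ ($\infty$ if no such $n$ exists). A set $A\subset X$ is large if $B(A,\varepsilon)=X$ for some $\varepsilon\in\mathcal E$, and small if $L\setminus A$ is large for every large $L\subset X$; $\mathcal S(X)$ is the family of small subsets. The asymptotic dimension of a subset is computed with respect to its subspace coarse structure. *)

(* Defs.v *)
From mathcomp Require Import all_boot all_order all_algebra.
From mathcomp Require Import boolp classical_sets reals.
From Stdlib Require List.
Set Implicit Arguments. Unset Strict Implicit. Unset Printing Implicit Defensive.
Import Order.TTheory GRing.Theory Num.Theory.
Local Open Scope classical_set_scope.
Local Open Scope ring_scope.

Section Coarse.
Variable T : Type.

Definition entourages := set (set (T * T)).

Definition cball (e : set (T * T)) (x : T) : set T := [set y | e (x, y)].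

Definition cballA (e : set (T * T)) (A : set T) : set T :=
  [set y | exists2 a, A a & e (a, y)].

Definition mesh (U : set (set T)) : set (T * T) :=
  [set p | exists2 V, U V & V p.1 /\ V p.2].

Definition sub_ent (E : entourages) (A : set T) : entourages :=
  [set e | exists2 e0, E e0 & e = e0 `&` (A `*` A)].

Definition is_cover (U : set (set T)) (A : set T) : Prop :=
  (forall V, U V -> V `<=` A) /\ (forall x, A x -> exists2 V, U V & V x).

Definition meets_at_most (U : set (set T)) (B : set T) (k : nat) : Prop :=
  exists s : list (set T), (length s <= k)%N /\
    forall V, U V -> V `&` B !=set0 -> List.In V s.

Definition asdim_le (E : entourages) (A : set T) (m : nat) : Prop :=
  forall eps, sub_ent E A eps ->
    exists U : set (set T), is_cover U A /\
      (exists2 delta, sub_ent E A delta & mesh U `<=` delta) /\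
      (forall x, A x -> meets_at_most U (cball eps x) m.+1).

Lemma asdim_ex (E : entourages) (A : set T) :
  (exists m, asdim_le E A m) -> exists m, `[< asdim_le E A m >].
Proof. by case=> m hm; exists m; apply/asboolP. Qed.

(** asdim(A) : Some m (least such m) or None (= infinity) *)
Definition asdim (E : entourages) (A : set T) : option nat :=
  match pselect (exists m, asdim_le E A m) with
  | left h => Some (ex_minn (asdim_ex h))
  | right _ => None
  end.

Definition large (E : entourages) (L : set T) : Prop :=
  exists2 e, E e & cballA e L = setT.

Definition small (E : entourages) (A : set T) : Prop :=
  forall L, large E L -> large E (L `\` A).

Definition metric_coarse (R : realType) (d : T -> T -> R) : entourages :=
  [set e | (forall x, e (x, x)) /\ (forall x y, e (x, y) -> e (y, x)) /\
           exists r : R, e `<=` [set p | d p.1 p.2 < r]].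
End Coarse.

Definition olt (a b : option nat) : Prop :=
  match a, b with
  | Some a, Some b => (a < b)%N
  | Some _, None => True
  | None, _ => False
  end.

Definition euclid_dist (R : realType) (n : nat) (x y : 'rV[R]_n) : R :=
  Num.sqrt (\sum_(i < n) (x ord0 i - y ord0 i) ^+ 2).

(* Main.v *)
Require Import Defs.
From mathcomp Require Import all_boot all_order all_algebra.
From mathcomp Require Import boolp classical_sets reals.
From mathcomp Require Import zify ring lra.
Set Implicit Arguments. Unset Strict Implicit. Unset Printing Implicit Defensive.
Import Order.TTheory GRing.Theory Num.Theory.
Local Open Scope classical_set_scope.
Local Open Scope ring_scope.

(** If [A] is not small, some [r]-dense set has arbitrarily large balls inside which it is contained
in [A], so [A] is [r]-dense in arbitrarily large cubes. A cover of [A] of bounded mesh then labels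
the vertices of a fine grid in such a cube so that no label reaches two opposite faces, and the
cubical Sperner lemma of Kuhn yields a grid cell with [n + 1] distinct labels: [asdim A >= n].

If [A] is small, then for every [r] there is a [D] such that every cube of the [D]-grid contains,
near its centre, a point at distance at least [r] from [A]. Projecting every cube radially from
this point to its boundary maps [A] to the [(n-1)]-skeleton of the grid, and in units of [D] two
points at distance [s] have images at distance [O(s / r)], however large [D] is. For [r] large
compared with [s], pulling back the partition of the skeleton into neighbourhoods of its cells, of
codimension [1, ..., n], gives a cover of [A] of bounded mesh such that every [s]-ball meets at most
one member per codimension. Without the projection, the codimensions [0, ..., n] give
[asdim R^n <= n]. *)

(** * Kuhn's cubical Sperner lemma *)

Section Kuhn.

Definition upd (v : nat -> nat) (i a : nat) : nat -> nat :=
  fun j => if j == i then a else v j.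
Definition shift (i : nat) (v : nat -> nat) : nat -> nat := upd v i (v i).+1.

Lemma addrr_F2 (x : 'F_2) : x + x = 0.
Proof. by rewrite addrr_pchar2 // pchar_Fp. Qed.

Lemma updC v i j a b : i != j -> upd (upd v i a) j b = upd (upd v j b) i a.
Proof.
move=> ne; apply/funext => k; rewrite /upd.
by case: (eqVneq k j) => [->|//]; rewrite eq_sym (negbTE ne).
Qed.

Lemma shift_upd v i j a : i != j -> shift j (upd v i a) = upd (shift j v) i a.
Proof. by move=> ne; rewrite /shift updC // /upd eq_sym (negbTE ne). Qed.

Lemma shiftC v i j : shift i (shift j v) = shift j (shift i v).
Proof.
case: (eqVneq i j) => [->//|ne]; apply/funext => k; rewrite /shift /upd.
rewrite (negbTE ne) [j == i]eq_sym (negbTE ne).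
by case: (eqVneq k j) => [->|//]; rewrite [j == i]eq_sym (negbTE ne).
Qed.

Lemma shift_upd_same v i a : shift i (upd v i a) = upd v i a.+1.
Proof. by apply/funext => k; rewrite /shift /upd eqxx; case: eqP. Qed.

(** Every unordered pair is counted twice, and this vanishes in characteristic 2. *)
Lemma sum_symmetric_pairs (s : seq nat) (F : nat -> nat -> 'F_2) :
  uniq s -> (forall i j, F i j = F j i) ->
  \sum_(i <- s) \sum_(j <- rem i s) F i j = 0.
Proof.
move=> us symF.
under eq_bigr => i _ do rewrite rem_filter // big_filter /=.
elim: s us => [_|x s IH /= /andP[xs us]]; first by rewrite big_nil.
rewrite big_cons big_cons /= eqxx /=.
under [X in _ + X]eq_bigr => i _ do rewrite big_cons /=.
rewrite (eq_big_seq (fun i => F i x + \sum_(j <- s | j != i) F i j)); last first.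
  move=> i si; case: ifP => // /negbFE /eqP xi; by rewrite xi si in xs.
rewrite big_split /= IH // addr0.
rewrite big_seq_cond.
rewrite (eq_bigl (fun i => i \in s)); last first.
  move=> i; case si: (i \in s) => //=; apply/eqP => ix; by rewrite -ix si in xs.
rewrite -big_seq [X in X + _](eq_bigr (F^~ x)) ?addrr_F2 // => i _; exact: symF.
Qed.

Variable lab : (nat -> nat) -> nat.

(* Sum of [h] over the label sequences of the Kuhn simplices [v, v + e_i1, v + e_i1 + e_i2, ...]
   where [i1, i2, ...] enumerates [s] (of size [m]). *)
Fixpoint kuhn_sum (m : nat) (s : seq nat) (h : seq nat -> 'F_2) (v : nat -> nat) : 'F_2 :=
  if m is m'.+1 then
    \sum_(i <- s) kuhn_sum m' (rem i s) (fun l => h (lab v :: l)) (shift i v)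
  else h [:: lab v].

(** The dual of the simplicial boundary modulo 2: each summand deletes one entry of [l]. *)
Fixpoint coboundary (g : seq nat -> 'F_2) (l : seq nat) : 'F_2 :=
  if l is x :: l' then g l' + coboundary (fun k => g (x :: k)) l' else 0.

Lemma kuhn_sumD m s h1 h2 v :
  kuhn_sum m s (fun l => h1 l + h2 l) v = kuhn_sum m s h1 v + kuhn_sum m s h2 v.
Proof.
elim: m s h1 h2 v => [//|m IH] s h1 h2 v /=.
by rewrite -big_split; apply: eq_bigr => i _; rewrite IH.
Qed.

(** Deleting an inner vertex of a Kuhn simplex gives a face shared with the simplex in which two
    consecutive directions are swapped, so these faces cancel. Deleting the first or the last vertex
    leaves a simplex in one of two opposite facets of the cube. *)
Lemma kuhn_coboundary m s g v : uniq s -> size s = m.+1 ->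
  kuhn_sum m.+1 s (coboundary g) v =
  \sum_(i <- s) (kuhn_sum m (rem i s) g (shift i v) + kuhn_sum m (rem i s) g v).
Proof.
elim: m s g v => [|m IH] s g v us ss.
  case: s us ss => [//|i [|//]] _ _.
  by rewrite /= !big_seq1 /= addr0.
have -> : kuhn_sum m.+2 s (coboundary g) v =
  \sum_(i <- s) (kuhn_sum m.+1 (rem i s) g (shift i v) +
    kuhn_sum m.+1 (rem i s) (coboundary (fun k => g (lab v :: k))) (shift i v)).
  by apply: eq_bigr => i _; rewrite -kuhn_sumD.
rewrite !big_split; congr (_ + _).
set h := fun k => g (lab v :: k).
rewrite (eq_big_seq (fun i => \sum_(j <- rem i s)
    kuhn_sum m (rem j (rem i s)) h (shift j (shift i v)) +
    \sum_(j <- rem i s) kuhn_sum m (rem j (rem i s)) h (shift i v))); last first.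
  by move=> i si; rewrite IH ?rem_uniq ?size_rem ?ss // big_split.
have remC i j : rem j (rem i s) = rem i (rem j s).
  rewrite !rem_filter ?filter_uniq // -!filter_predI.
  by apply: eq_filter => k /=; rewrite andbC.
rewrite big_split /=.
rewrite sum_symmetric_pairs ?add0r //; last by move=> i j; rewrite remC shiftC.
have swap (F : nat -> nat -> 'F_2) :
    \sum_(i <- s) \sum_(j <- rem i s) F i j = \sum_(j <- s) \sum_(i <- rem j s) F i j.
  under eq_bigr => i _ do rewrite rem_filter // big_filter big_mkcond /=.
  rewrite exchange_big /=; apply: eq_bigr => j _.
  rewrite rem_filter // big_filter [RHS]big_mkcond /=.
  by apply: eq_bigr => i _; rewrite eq_sym.
rewrite swap; apply: eq_bigr => j _; apply: eq_bigr => i _.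
by rewrite remC.
Qed.

Definition cube_vertex (s : seq nat) (v u : nat -> nat) : Prop :=
  forall j, (v j <= u j <= v j + (j \in s))%N.

Lemma kuhn_sum_eq m s h1 h2 v : uniq s -> size s = m ->
  (forall l, size l = m.+1 ->
     (forall c, c \in l -> exists2 u, cube_vertex s v u & lab u = c) -> h1 l = h2 l) ->
  kuhn_sum m s h1 v = kuhn_sum m s h2 v.
Proof.
elim: m s h1 h2 v => [|m IH] s h1 h2 v us ss eqh /=.
  apply: eqh => // c; rewrite inE => /eqP ->; exists v => // j; lia.
apply: eq_big_seq => i si; apply: IH; rewrite ?rem_uniq ?size_rem ?ss //.
move=> l sl vl; apply: eqh; first by rewrite /= sl.
move=> c; rewrite inE => /orP[/eqP ->|/vl[u uv <-]].
  by exists v => // j; lia.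
exists u => // j; have := uv j.
rewrite rem_filter // mem_filter /= /shift /upd.
case: eqP => [->|] /=; last by lia.
by rewrite si; lia.
Qed.

Lemma kuhn_sum0 m s h v : uniq s -> size s = m ->
  (forall l, size l = m.+1 ->
     (forall c, c \in l -> exists2 u, cube_vertex s v u & lab u = c) -> h l = 0) ->
  kuhn_sum m s h v = 0.
Proof.
move=> us ss hl; rewrite (kuhn_sum_eq us ss hl).
elim: m s v {h us ss hl} => [//|m IH] s v /=.
by rewrite big1.
Qed.

Variable N : nat.

(** The argument [w] fixes the coordinates from [k] on, so the sum runs over a [k]-dimensional slice
    and inductions can pass to faces. *)
Fixpoint box_sum (k : nat) (G : (nat -> nat) -> 'F_2) (w : nat -> nat) : 'F_2 :=
  if k is k'.+1 then \sum_(0 <= a < N) box_sum k' G (upd w k' a) else G w.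

Lemma box_sum_eq k G1 G2 w :
  (forall v, (forall j, (k <= j)%N -> v j = w j) -> G1 v = G2 v) ->
  box_sum k G1 w = box_sum k G2 w.
Proof.
elim: k w => [|k IH] w eqG /=; first exact: eqG.
apply: eq_bigr => a _; apply: IH => v vw; apply: eqG => j kj.
by rewrite vw ?(ltnW kj) // /upd gtn_eqF.
Qed.

Lemma box_sum0 k w : box_sum k (fun=> 0) w = 0.
Proof. by elim: k w => [//|k IH] w /=; rewrite big1. Qed.

Lemma box_sumD k G1 G2 w :
  box_sum k (fun v => G1 v + G2 v) w = box_sum k G1 w + box_sum k G2 w.
Proof.
elim: k w => [//|k IH] w /=.
by rewrite -big_split; apply: eq_bigr => a _; rewrite IH.
Qed.

Lemma box_sum_sum k (s : seq nat) (G : nat -> (nat -> nat) -> 'F_2) w :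
  box_sum k (fun v => \sum_(i <- s) G i v) w = \sum_(i <- s) box_sum k (G i) w.
Proof.
elim: s => [|i s IH].
  by rewrite big_nil; apply: etrans (box_sum0 k w); apply: box_sum_eq => v _; rewrite big_nil.
rewrite big_cons -IH -box_sumD; apply: box_sum_eq => v _; exact: big_cons.
Qed.

Lemma box_sum_shift k i G w : (k <= i)%N ->
  box_sum k (fun v => G (shift i v)) w = box_sum k G (shift i w).
Proof.
elim: k w => [//|k IH] w ki /=.
by apply: eq_bigr => a _; rewrite IH ?(ltnW ki) // shift_upd // ltn_eqF.
Qed.

Lemma box_sum_telescope k G w :
  box_sum k.+1 (fun v => G (shift k v) + G v) w =
  box_sum k G (upd w k N) + box_sum k G (upd w k 0).
Proof.
rewrite /=.
rewrite (eq_bigr (fun a => box_sum k G (upd w k a.+1) - box_sum k G (upd w k a))).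
  by rewrite telescope_sumr // oppr_pchar2 // pchar_Fp.
by move=> a _; rewrite box_sumD box_sum_shift // shift_upd_same oppr_pchar2 // pchar_Fp.
Qed.

(** Along direction [i] the sum telescopes to the two opposite faces, where [G] vanishes.
    Telescoping is direct only for the outermost summation, so the induction strips the coordinates
    above [i] first. *)
Lemma box_sum_shift0 k i G w : (i < k)%N ->
  (forall v, v i = 0%N -> (forall j, (k <= j)%N -> v j = w j) -> G v = 0) ->
  (forall v, v i = N -> (forall j, (k <= j)%N -> v j = w j) -> G v = 0) ->
  box_sum k (fun v => G (shift i v) + G v) w = 0.
Proof.
elim: k w => [//|k IH] w ik G0 GN.
have agree a v : (forall j, (k <= j)%N -> v j = upd w k a j) ->
    forall j, (k < j)%N -> v j = w j.
  by move=> vw j kj; rewrite vw ?(ltnW kj) // /upd gtn_eqF.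
move: ik; rewrite ltnS leq_eqVlt => /orP[/eqP ik|ik].
- subst i; rewrite box_sum_telescope -[RHS]addr0; congr (_ + _).
  + rewrite -(box_sum0 k (upd w k N)); apply: box_sum_eq => v vw.
    by apply: GN; [rewrite vw // /upd eqxx|apply: agree vw].
  + rewrite -(box_sum0 k (upd w k 0)); apply: box_sum_eq => v vw.
    by apply: G0; [rewrite vw // /upd eqxx|apply: agree vw].
- rewrite /= big1 // => a _; apply: IH => // v vi vw; [apply: G0|apply: GN] => //;
    exact: agree vw.
Qed.

Definition rainbow (k : nat) (l : seq nat) : 'F_2 := (perm_eq l (iota 0 k.+1))%:R.

Lemma box_sum_exists k G w : box_sum k G w != 0 -> exists v, G v != 0.
Proof.
move=> nz; apply/not_existsP => G0; move/eqP: nz; apply.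
rewrite -(box_sum0 k w); apply: box_sum_eq => v _; apply/eqP/negP => /negP.
exact: G0.
Qed.

Lemma coboundary_perm_invariant (g : seq nat -> 'F_2) (l : seq nat) :
  (forall l1 l2, perm_eq l1 l2 -> g l1 = g l2) ->
  coboundary g l = \sum_(x <- l) g (rem x l).
Proof.
elim: l g => [|x l IH] g gP; first by rewrite big_nil.
rewrite big_cons /= eqxx IH; last by move=> l1 l2 p; apply: gP; rewrite perm_cons.
congr (_ + _); apply: eq_big_seq => y yl; case: eqP => [xy|//].
by apply: gP; rewrite xy perm_sym perm_to_rem.
Qed.

Lemma perm_cons_same (x y : nat) t : perm_eq (x :: t) (y :: t) = (x == y).
Proof.
rewrite -(cat1s x) -(cat1s y) perm_cat2r; apply/idP/eqP => [p|->//].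
by have := perm_mem p x; rewrite !inE eqxx => /esym /eqP.
Qed.

(** The door count in Sperner's argument. If [l] consists of [0, ..., k] and one further label [x0],
    two deletions leave a rainbow facet when [x0 <= k], namely those of the two copies of [x0], and
    one when [x0 = k.+1]. Otherwise no deletion does. *)
Lemma coboundary_rainbow k l : (forall c, c \in l -> (c <= k.+1)%N) ->
  coboundary (rainbow k) l = rainbow k.+1 l.
Proof.
move=> lk; rewrite /rainbow coboundary_perm_invariant; last first.
  by move=> l1 l2 /permPl ->.
set t := iota 0 k.+1.
have -> : iota 0 k.+2 = t ++ [:: k.+1] by rewrite -addn1 iotaD.
have -> : perm_eq l (t ++ [:: k.+1]) = perm_eq l (k.+1 :: t).
  by rewrite perm_sym perm_catC perm_sym.
have remE x : x \in l -> perm_eq (rem x l) t = perm_eq l (x :: t).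
  by move=> xl; rewrite (permPl (perm_to_rem xl)) perm_cons.
rewrite (eq_big_seq (fun x => (perm_eq l (x :: t))%:R)); last first.
  by move=> x xl; rewrite remE.
case: (pselect (exists x, perm_eq l (x :: t))) => [[x0 px]|none]; last first.
  have no x : perm_eq l (x :: t) = false.
    by apply/negP => px; apply: none; exists x.
  by rewrite big1 ?no // => x _; rewrite no.
rewrite (perm_big _ px) big_cons (permPl px) perm_cons_same eqxx.
rewrite (eq_bigr (fun x => (x == x0)%:R)); last first.
  by move=> x _; rewrite (permPl px) perm_cons_same eq_sym.
rewrite (permPl px) perm_cons_same.
have /lk x0k : x0 \in l by rewrite (perm_mem px) inE eqxx.
have -> : \sum_(x <- t) (x == x0)%:R = (x0 \in t)%:R :> 'F_2.
  rewrite -natr_sum -(count_uniq_mem x0 (iota_uniq 0 k.+1)) -sum1_count [in RHS]big_mkcond.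
  by congr _%:R; apply: eq_bigr => x _ /=; case: eqP.
rewrite mem_iota /= add0n ltnS.
by case: (ltngtP x0 k.+1) x0k => // h _; case: leqP; rewrite ?addrr_F2 ?addr0 //; lia.
Qed.

(** Existence follows from parity. Modulo 2, the rainbow simplices of a face are counted by the
    rainbow facets on its boundary, and the conditions on labels leave only those in the next
    smaller face. *)
Lemma cubical_sperner (n : nat) : (0 < N)%N ->
  (forall v, lab v <= n)%N ->
  (forall v i, (i < n)%N -> v i = 0%N -> (lab v <= i)%N) ->
  (forall v i, (i < n)%N -> v i = N -> lab v != i) ->
  exists v, forall c, (c <= n)%N ->
    exists2 u, (forall j, v j <= u j <= (v j).+1)%N & lab u = c.
Proof.
move=> N0 labn lab0 labN.
(* The face in question has all coordinates from [k] on equal to 0; its labels are at most [k]. *)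
have odd k : (k <= n)%N ->
    box_sum k (kuhn_sum k (iota 0 k) (rainbow k)) (fun=> 0%N) = 1.
  elim: k => [_|k IH kn].
    have -> : box_sum 0 (kuhn_sum 0 (iota 0 0) (rainbow 0)) (fun=> 0%N)
        = rainbow 0 [:: lab (fun=> 0%N)] by [].
    have : (lab (fun=> 0%N) <= 0)%N.
      by case: (posnP n) => [<-|n0]; [exact: labn|exact: lab0].
    by rewrite leqn0 /rainbow => /eqP ->.
  have uk : uniq (iota 0 k.+1) by exact: iota_uniq.
  have szk : size (iota 0 k.+1) = k.+1 by exact: size_iota.
  rewrite (@box_sum_eq _ _ (fun v => \sum_(i <- iota 0 k.+1)
     (kuhn_sum k (rem i (iota 0 k.+1)) (rainbow k) (shift i v) +
      kuhn_sum k (rem i (iota 0 k.+1)) (rainbow k) v))); last first.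
    move=> v v0; rewrite -kuhn_coboundary //; apply: kuhn_sum_eq => // l sl vl.
    rewrite coboundary_rainbow // => c /vl[u uv <-].
    case: (ltngtP k.+1 n) kn => // [kn _|-> _]; last exact: labn.
    apply: lab0 => //; have := uv k.+1; rewrite v0 // mem_iota; lia.
  (* A facet orthogonal to direction [i] that misses some label [c <= k] contributes nothing. *)
  have facet0 i v c : (i < k.+1)%N -> (c <= k)%N ->
      (forall u, u i = v i -> lab u != c) ->
      kuhn_sum k (rem i (iota 0 k.+1)) (rainbow k) v = 0.
    move=> ik ck noc; apply: kuhn_sum0.
    - exact: rem_uniq.
    - by rewrite size_rem ?szk // mem_iota.
    move=> l sl vl; rewrite /rainbow; case: (boolP (perm_eq _ _)) => // p.
    have /vl[u uv uc] : c \in l by rewrite (perm_mem p) mem_iota; lia.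
    have := uv i; rewrite rem_filter // mem_filter /= eqxx /= addn0 => ui.
    have uiv : u i = v i by lia.
    by have := noc u uiv; rewrite uc eqxx.
  have sum_last (F : nat -> 'F_2) :
      \sum_(i <- iota 0 k.+1) F i = \sum_(i <- iota 0 k) F i + F k.
    by rewrite -[k.+1]addn1 iotaD big_cat big_seq1.
  (* For [i < k] both boundary faces drop out: label [k] is missing where [v i = 0], label [i] where
     [v i = N]. In direction [k] the face at [N] misses label [k], and the face at 0 is the
     induction hypothesis. *)
  rewrite box_sum_sum sum_last [X in X + _]big_seq big1 ?add0r; last first.
    move=> i; rewrite mem_iota add0n => /andP[_ ik].
    apply: (@box_sum_shift0 _ i (kuhn_sum k (rem i (iota 0 k.+1)) (rainbow k))).
    - by lia.
    - move=> v vi _; apply: (@facet0 i v k) => //; first by lia.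
      move=> u; rewrite vi => ui; have := lab0 u i _ ui; lia.
    - move=> v vi _; apply: (@facet0 i v i) => //; try lia.
      move=> u; rewrite vi => ui; apply: labN => //; lia.
  rewrite (box_sum_telescope k (kuhn_sum k (rem k (iota 0 k.+1)) (rainbow k))).
  rewrite (@box_sum_eq _ _ (fun=> 0)); last first.
    move=> v vN; apply: (@facet0 k v k) => // u uv; apply: labN => //.
    by rewrite uv vN // /upd eqxx.
  rewrite box_sum0 add0r -(IH (ltnW kn)).
  have -> : rem k (iota 0 k.+1) = iota 0 k.
    rewrite -[k.+1]addn1 iotaD rem_filter -?iotaD ?iota_uniq // iotaD filter_cat /=.
    rewrite add0n eqxx /= cats0; apply/all_filterP/allP => i; rewrite mem_iota /=; lia.
  by congr box_sum; apply/funext => j; rewrite /upd; case: eqP.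
have /box_sum_exists[v nz] : box_sum n (kuhn_sum n (iota 0 n) (rainbow n)) (fun=> 0%N) != 0.
  by rewrite odd ?oner_eq0.
exists v => c cn; apply: contrapT => noc; move/eqP: nz; apply.
apply: kuhn_sum0; rewrite ?iota_uniq ?size_iota //.
move=> l sl vl; rewrite /rainbow; case: (boolP (perm_eq _ _)) => // p.
have /vl[u uv uc] : c \in l by rewrite (perm_mem p) mem_iota; lia.
case: noc; exists u => // j; have := uv j; lia.
Qed.
End Kuhn.

(** * Lower bound for the asymptotic dimension *)

Section Euclid.
Variables (R : realType) (n : nat).
Implicit Types (x y : 'rV[R]_n) (A L : set 'rV[R]_n).
Local Notation dist := (@euclid_dist R n).
Local Notation E := (metric_coarse dist).

Lemma coord_le_dist x y i : `|x ord0 i - y ord0 i| <= dist x y.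
Proof.
rewrite /euclid_dist -sqrtr_sqr ler_wsqrtr // (bigD1 i) //= lerDl.
by apply: sumr_ge0 => j _; rewrite sqr_ge0.
Qed.

Lemma dist_le_coord x y c : 0 <= c ->
  (forall i, `|x ord0 i - y ord0 i| <= c) -> dist x y <= n%:R * c.
Proof.
move=> c0 xyc; have nc0 : 0 <= n%:R * c by rewrite mulr_ge0.
rewrite /euclid_dist -(ger0_norm nc0) -sqrtr_sqr ler_wsqrtr //.
apply: (@le_trans _ _ (\sum_(i < n) c ^+ 2)).
  by apply: ler_sum => i _; rewrite -[X in X <= _]real_normK ?num_real // lerXn2r ?nnegrE.
rewrite sumr_const card_ord -[leLHS]mulr_natl exprMn ler_wpM2r ?sqr_ge0 //.
by rewrite -natrX ler_nat; case: n => // k; rewrite expnS expn1; nia.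
Qed.

Lemma distC x y : dist x y = dist y x.
Proof.
rewrite /euclid_dist; congr Num.sqrt; apply: eq_bigr => i _.
by rewrite -[LHS]sqrrN opprB.
Qed.

Lemma distxx x : dist x x = 0.
Proof. by rewrite /euclid_dist big1 ?sqrtr0 // => i _; rewrite subrr expr0n. Qed.

Lemma ball_entourage r : 0 < r -> E [set p | dist p.1 p.2 < r].
Proof.
move=> r0; split; first by move=> x /=; rewrite distxx.
by split; [move=> x y /=; rewrite distC|exists r].
Qed.

Lemma largeP L : large E L <->
  exists r, 0 < r /\ forall y, exists2 a, L a & dist a y < r.
Proof.
split=> [[e [_ [_ [r er]]] eL]|[r [r0 Lr]]].
  exists (`|r| + 1); split; first by have := normr_ge0 r; lra.
  move=> y; have [a La /er /= ay] : cballA e L y by rewrite eL.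
  by exists a => //; have := ler_norm r; lra.
exists [set p | dist p.1 p.2 < r]; first exact: ball_entourage.
by apply/seteqP; split => // y _; have [a La ay] := Lr y; exists a.
Qed.

Lemma asdim_lt_small m A : (m < n)%N -> asdim_le E A m -> small E A.
Proof.
move=> mn dimA L /largeP[r [r0 Ldense]]; apply: contrapT => nlarge.
(* As [L] without [A] is not large, it misses arbitrarily large balls. *)
have far rho : 0 < rho -> exists x, forall a, L a -> dist a x < rho -> A a.
  move=> rho0; apply: contrapT => nfar; apply: nlarge; apply/largeP.
  exists rho; split => // y; apply: contrapT => ny; apply: nfar; exists y => a La ay.
  by apply: contrapT => nAa; apply: ny; exists a.
(* Samples of neighbouring grid vertices differ by at most [3 * r] per coordinate: [r] for the grid
   step and [r] for each approximation. *)
pose s := n%:R * (3 * r) + 1.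
have s0 : 0 < s by have := ler0n R n; rewrite /s; nra.
have [|U [[UA Ucov] [[_ [e [_ [_ [D eD]]] ->] meshU] mult]]] :=
  dimA ([set p | dist p.1 p.2 < s] `&` A `*` A).
  by exists [set p | dist p.1 p.2 < s] => //; exact: ball_entourage.
(* Opposite faces are [N%:R * r] apart, so samples near them are more than [D] apart. *)
pose N := Num.bound ((`|D| + 2 * r) / r).
have Nr : `|D| + 2 * r < N%:R * r.
  by rewrite -ltr_pdivrMr //; apply: archi_boundP; apply: divr_ge0; have := normr_ge0 D; lra.
have N0 : (0 < N)%N.
  by rewrite lt0n; apply/eqP => N0; move: Nr; rewrite N0; have := normr_ge0 D; lra.
pose rho := n%:R * (N%:R * r + r) + 1.
have rho0 : 0 < rho.
  rewrite /rho; have : 0 <= n%:R * (N%:R * r + r).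
    by rewrite mulr_ge0 // addr_ge0 ?mulr_ge0 // ltW.
  by lra.
have [x Ax] := far rho rho0.
(* Truncation at [N] makes the labelling total on [nat -> nat]; the cell found by [cubical_sperner]
   need not lie in the box. *)
pose q (v : nat -> nat) : 'rV[R]_n := \row_i (x ord0 i + (minn (v i) N)%:R * r).
have /choice[a aP] v : exists a, A a /\ forall i, `|a ord0 i - q v ord0 i| < r.
  have [b Lb bq] := Ldense (q v); exists b.
  have bqi i : `|b ord0 i - q v ord0 i| < r by exact: le_lt_trans (coord_le_dist _ _ i) bq.
  split => //; apply: Ax => //; apply: (@le_lt_trans _ _ (n%:R * (N%:R * r + r))).
    apply: dist_le_coord; first by rewrite addr_ge0 ?mulr_ge0 // ltW.
    move=> i; have := bqi i; rewrite mxE !ltr_norml ler_norml.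
    have : (minn (v i) N)%:R * r <= N%:R * r by rewrite ler_wpM2r ?ler_nat ?geq_minr // ltW.
    have : 0 <= (minn (v i) N)%:R * r by rewrite mulr_ge0 // ltW.
    by lra.
  by rewrite /rho; lra.
have /choice[V VP] v : exists W, U W /\ W (a v).
  by have [W UW Wa] := Ucov (a v) (aP v).1; exists W.
(* The colour of [W] is the first [i] such that [W] is assigned to a vertex of the face [u i = 0],
   and [n] if there is none. A vertex with [v i = N] cannot have colour [i], since its set would
   then join opposite faces. *)
pose touch (W : set 'rV[R]_n) (i : nat) := `[< exists u, u i = 0%N /\ V u = W >].
pose color (W : set 'rV[R]_n) := find (touch W) (iota 0 n).
have [| | | |v vP] := @cubical_sperner (fun v => color (V v)) N n.
- by [].
- by move=> v; rewrite -[leqRHS](size_iota 0 n) find_size.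
- move=> v i iltn vi; rewrite leqNgt; apply/negP => /(before_find 0%N).
  by rewrite nth_iota // add0n => /asboolP; apply; exists v.
- move=> v i iltn vi; apply/eqP; rewrite /= /color => ci.
  have : has (touch (V v)) (iota 0 n) by rewrite has_find ci size_iota.
  move/(nth_find 0%N); rewrite ci nth_iota // add0n => /asboolP[u [ui Vuv]].
  have : mesh U (a u, a v) by exists (V v); [exact: (VP v).1|split; [rewrite -Vuv|]; exact: (VP _).2].
  move=> /meshU[/eD /= auv _].
  have := le_lt_trans (coord_le_dist _ _ (Ordinal iltn)) auv.
  have := (aP u).2 (Ordinal iltn); have := (aP v).2 (Ordinal iltn).
  rewrite !mxE /= ui vi minnn min0n mul0r addr0 !ltr_norml.
  have := ler_norm D; lra.
have [t [szt tP]] := mult (a v) (aP v).1.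
(* The [n.+1] colours of the cell come from different members of [U], all meeting the [s]-ball at
   [a v], while [t] has at most [m.+1 <= n] entries. *)
have : (size (iota 0 n.+1) <= size (map color t))%N.
  apply: uniq_leq_size; first exact: iota_uniq.
  move=> c; rewrite mem_iota add0n ltnS => /vP[u uv <-].
  have : List.In (V u) t.
    apply: tP; first exact: (VP u).1.
    exists (a u); split; first exact: (VP u).2.
    split; last by split; [exact: (aP v).1|exact: (aP u).1].
    rewrite /=; apply: (@le_lt_trans _ _ (n%:R * (3 * r))); last by rewrite /s; lra.
    apply: dist_le_coord; first lra.
    move=> i; have := (aP u).2 i; have := (aP v).2 i; rewrite !mxE !ltr_norml ler_norml.
    have [d [-> dr]] : exists d, (minn (u i) N)%:R = (minn (v i) N)%:R + d :> R /\ 0 <= d <= 1.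
      exists ((minn (u i) N)%:R - (minn (v i) N)%:R); split; first lra.
      have := uv i => /andP[uv1 uv2].
      have h1 : (minn (v i) N <= minn (u i) N)%N by lia.
      have h2 : (minn (u i) N <= (minn (v i) N) + 1)%N by lia.
      by move: h1 h2; rewrite -!(ler_nat R) natrD; lra.
    rewrite mulrDl; have : 0 <= d * r <= r by nra.
    by lra.
  elim: t {tP szt} => [//|W t IH] /= [->|/IH]; rewrite inE ?eqxx // => ->.
  by rewrite orbT.
rewrite size_iota size_map; have -> : size t = length t by [].
lia.
Qed.
End Euclid.

(** * Neighbourhoods of the cells of the unit grid *)

Section NearWalls.
Variable R : realType.
Implicit Types (t u tau kap : R) (z : int).

Definition nearest (t : R) : int := Num.floor (t + 2^-1).
Definition near (tau t : R) : bool := `|t - (nearest t)%:~R| <= tau.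
Definition wall_label (tau t : R) : bool * int :=
  if near tau t then (true, nearest t) else (false, Num.floor t).

Lemma nearestE t z : `|t - z%:~R| < 2^-1 -> nearest t = z.
Proof.
rewrite ltr_norml => tz; apply: floor_def; rewrite intrD; lra.
Qed.

Lemma near_of_int tau t z : tau < 2^-1 -> `|t - z%:~R| <= tau -> near tau t.
Proof. by move=> tau2 tz; rewrite /near (nearestE (le_lt_trans tz tau2)). Qed.

Lemma near_le tau tau' t : tau <= tau' -> near tau t -> near tau' t.
Proof. by move=> h /le_trans; apply. Qed.

(** If the floors were in the other order, the integer [Num.floor t] would lie between [u] and [t],
    hence within [tau] of [u]. *)
Lemma not_near_floor tau t u : tau < 2^-1 -> `|t - u| <= tau ->
  ~~ near tau t -> ~~ near tau u -> (Num.floor t <= Num.floor u).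
Proof.
move=> tau2 tu nt nu; rewrite leNgt; apply/negP.
rewrite floor_lt_int => ut.
have tf := floor_le t.
move/negP: nu; apply; apply: (@near_of_int _ _ (Num.floor t)) => //.
by move: tu; rewrite !ler_norml; lra.
Qed.

(** If [t] is near a wall, [u] is within [tau + kap] of it, and the assumed gap improves this to
    [tau]; below [1/2] the wall is unique. If neither is near a wall, no integer separates them. *)
Lemma wall_label_eq tau kap t u : 0 <= tau -> 0 <= kap -> tau + kap <= 4^-1 ->
  `|t - u| <= kap ->
  (near (tau + kap) t -> near tau t) -> (near (tau + kap) u -> near tau u) ->
  wall_label tau t = wall_label tau u.
Proof.
move=> tau0 kap0 tk tu nt nu.
have key x y : `|x - y| <= kap -> near tau x -> `|y - (nearest x)%:~R| <= tau + kap.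
  by rewrite /near !ler_norml; lra.
have ut : `|u - t| <= kap by rewrite distrC.
have tk2 : tau + kap < 2^-1 by lra.
rewrite /wall_label.
case: (boolP (near tau t)) => [neart|nott].
  have h := key _ _ tu neart.
  by rewrite (nu (near_of_int tk2 h)) (nearestE (le_lt_trans h tk2)).
case: (boolP (near tau u)) => [nearu|notu].
  have h := key _ _ ut nearu.
  by rewrite (nt (near_of_int tk2 h)) in nott.
have nott' : ~~ near (tau + kap) t by apply: contra nott.
have notu' : ~~ near (tau + kap) u by apply: contra notu.
congr (_, _); apply/eqP; rewrite eq_le.
by rewrite !(@not_near_floor (tau + kap)) //; lra.
Qed.

Lemma wall_label_dist tau t u : tau <= 4^-1 ->
  wall_label tau t = wall_label tau u -> `|t - u| <= 1.
Proof.
move=> tau4; rewrite /wall_label /near.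
case: ifP => nt; case: ifP => nu // -[] e.
  by move: nt nu; rewrite e !ler_norml; lra.
have := floor_itv t; have := floor_itv u; rewrite e !intrD ler_norml; lra.
Qed.
End NearWalls.

Section Cells.
Variables (R : realType) (n : nat).
Implicit Types (y : 'I_n -> R).

(** The spacing of the thresholds [tau m], small enough that all of them up to [tau n.+1] are at
    most [1/4]. *)
Definition kappa : R := (4 * n.+1%:R)^-1.
Definition tau (m : nat) : R := m%:R * kappa.

Lemma kappa_gt0 : 0 < kappa.
Proof. by rewrite invr_gt0 mulr_gt0. Qed.

Lemma tauS m : tau m.+1 = tau m + kappa.
Proof. by rewrite /tau -natr1 mulrDl mul1r. Qed.

Lemma tau_ge0 m : 0 <= tau m.
Proof. by rewrite mulr_ge0 // ltW ?kappa_gt0. Qed.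

Lemma tau_le m : (m <= n.+1)%N -> tau m <= 4^-1.
Proof.
move=> mn; apply: (@le_trans _ _ (n.+1%:R * kappa)).
  by rewrite ler_wpM2r ?ler_nat // ltW ?kappa_gt0.
by rewrite /kappa invfM mulrCA divff ?mulr1 // pnatr_eq0.
Qed.

Definition near_set (m : nat) y : {set 'I_n} := [set i | near (tau m) (y i)]%SET.

(** The threshold grows with [m], so that a neighbourhood of a lower-dimensional cell has room of
    width [kappa] around it. The default [ord0] always satisfies the condition. *)
Definition codim y : nat :=
  [arg max_(m > (ord0 : 'I_n.+1) | (m <= #|near_set m y|)%N) (m : nat)].

Lemma codimP y :
  [/\ (codim y <= n)%N, (codim y <= #|near_set (codim y) y|)%N &
      forall m, (m <= n)%N -> (m <= #|near_set m y|)%N -> (m <= codim y)%N].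
Proof.
rewrite /codim; case: arg_maxnP => // m mP mmax; split=> //.
  by rewrite -ltnS.
by move=> k kn kP; have := mmax (Ordinal (kn : (k < n.+1)%N)) kP.
Qed.

(* No coordinate has wall distance in (tau (codim y), tau (codim y).+1]: otherwise [codim y] would
   not be maximal.  This gap makes the label of a cell locally constant among points of equal
   codimension. *)
Lemma codim_gap y i : near (tau (codim y).+1) (y i) -> near (tau (codim y)) (y i).
Proof.
have [mn mP mmax] := codimP y; move: mn mP mmax; set m := codim y => mn mP mmax.
have sub : near_set m y \subset near_set m.+1 y.
  apply/fintype.subsetP => j; rewrite !inE; apply: near_le; rewrite tauS.
  by have := kappa_gt0; lra.
suff /eqP e : near_set m y == near_set m.+1 y.
  by have /setP/(_ i) := e; rewrite !inE => ->.
rewrite eqEcard sub /=; apply: leq_trans mP.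
case: (ltngtP m n) mn => // [mn _|-> _]; last by rewrite -[leqRHS]card_ord max_card.
by rewrite leqNgt; apply/negP => /(mmax _ mn); rewrite ltnn.
Qed.

Definition cell y : nat * ('I_n -> bool * int) :=
  (codim y, fun i => wall_label (tau (codim y)) (y i)).

Lemma cell_eq y y' : (forall i, `|y i - y' i| <= kappa) ->
  codim y = codim y' -> cell y = cell y'.
Proof.
move=> yy' e; rewrite /cell -e; congr (_, _); apply/funext => i.
have [mn _ _] := codimP y.
apply: (@wall_label_eq _ _ kappa) => //.
- exact: tau_ge0.
- exact: ltW kappa_gt0.
- by rewrite -tauS tau_le.
- by rewrite -tauS; apply: codim_gap.
- by rewrite -tauS e; apply: codim_gap.
Qed.

Lemma cell_dist y y' i : cell y = cell y' -> `|y i - y' i| <= 1.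
Proof.
case=> <- /(congr1 (@^~ i)); apply: wall_label_dist.
by have [mn _ _] := codimP y; rewrite tau_le // ltnW.
Qed.

(** On the skeleton codimension 0 does not occur, which saves one dimension in the cover. *)
Lemma codim_gt0 y j z : y j = z%:~R -> (0 < codim y)%N.
Proof.
move=> yj; have [_ _ mmax] := codimP y; apply: mmax.
  exact: leq_ltn_trans (leq0n j) (ltn_ord j).
rewrite card_gt0; apply/set0Pn; exists j; rewrite inE.
apply: (@near_of_int _ _ _ z); first by have := @tau_le 1 isT; lra.
by rewrite yj subrr normr0 tau_ge0.
Qed.
End Cells.

(** * Upper bounds for the asymptotic dimension from covers by cells *)

Section UpperBound.
Variables (R : realType) (n : nat).
Implicit Types (x y : 'rV[R]_n) (A L : set 'rV[R]_n).
Local Notation dist := (@euclid_dist R n).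
Local Notation E := (metric_coarse dist).

Lemma In_map_mem (I : eqType) (T : Type) (F : I -> T) (c : I) (s : seq I) :
  c \in s -> List.In (F c) (map F s).
Proof.
elim: s => [//|a s IH]; rewrite inE => /orP[/eqP ->|/IH h]; first by left.
by right.
Qed.

(* The members of the cover are the fibres of [cell \o f]; near a given point there is at most one
   of each codimension. *)
Lemma cells_asdim_le A (m0 : nat) : (m0 <= n)%N ->
  (forall s : R, 0 < s -> exists (D : R) (f : 'rV[R]_n -> 'I_n -> R), [/\ 0 < D,
     forall x i, A x -> `|f x i - x ord0 i / D| <= 1,
     forall x y, A x -> A y -> (forall i, `|x ord0 i - y ord0 i| <= 2 * s) ->
       forall i, `|f x i - f y i| <= kappa R n &
     forall x, A x -> (m0 <= codim (f x))%N]) ->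
  asdim_le E A (n - m0).
Proof.
move=> m0n Hf _ [e [_ [_ [r er]]] ->].
pose s := `|r| + 1.
have s0 : 0 < s by rewrite /s; have := normr_ge0 r; lra.
have [D [f [D0 fclose fcont fcodim]]] := Hf s s0.
pose fiber z : set 'rV[R]_n := [set y | A y /\ cell (f y) = cell (f z)].
exists [set W | exists2 z, A z & W = fiber z]; split; [split|split].
- by move=> _ [z Az ->] y [].
- by move=> x Ax; exists (fiber x); [exists x|split].
(* In units of [D], the 3 is 1 for the cell and 1 for each displacement by [f]. *)
- pose r' := n%:R * (3 * D) + 1.
  have r'0 : 0 < r' by rewrite /r'; have := ler0n R n; nra.
  exists ([set p | dist p.1 p.2 < r'] `&` A `*` A).
    by exists [set p | dist p.1 p.2 < r'] => //; exact: ball_entourage.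
  move=> [x y] [_ [z Az ->]] /= [[Ax xz] [Ay yz]]; split=> //=.
  apply: (@le_lt_trans _ _ (n%:R * (3 * D))); last by rewrite /r'; lra.
  apply: dist_le_coord; first lra.
  move=> i; have := fclose x i Ax; have := fclose y i Ay.
  have := @cell_dist _ _ (f x) (f y) i (etrans xz (esym yz)).
  rewrite !ler_norml => h1 h2 h3.
  have -> : x ord0 i - y ord0 i = (x ord0 i / D - y ord0 i / D) * D.
    by rewrite mulrBl !divfK // gt_eqF.
  have : - 3 <= x ord0 i / D - y ord0 i / D <= 3 by lra.
  set w := _ - _; nra.
move=> x Ax.
(* The fibre of codimension [c] that meets the ball, written without choosing a point of it, since
   there may be none. Points of the ball are within [2 * s] of each other, so [fcont] and [cell_eq]
   show that it is a single fibre. *)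
pose pick c : set 'rV[R]_n := [set y | A y /\ exists z,
  [/\ cball (e `&` A `*` A) x z, codim (f z) = c & cell (f y) = cell (f z)]].
exists (map pick (iota m0 (n - m0).+1)); split.
  by have -> : forall l : seq (set 'rV[R]_n), length l = size l by []; rewrite size_map size_iota.
move=> _ [w Aw ->] [z [[Az zw] xz]].
have -> : fiber w = pick (codim (f z)).
  apply/seteqP; split => y [Ay].
    by rewrite -zw => yz; split=> //; exists z.
  move=> [z' [xz' cz' yz']]; split=> //; rewrite yz' -zw.
  have [exz [_ _]] := xz; have [exz' [_ /= Az']] := xz'.
  apply: cell_eq => //; apply: fcont => // i.
  have := le_lt_trans (coord_le_dist _ _ i) (er _ exz).
  have := le_lt_trans (coord_le_dist _ _ i) (er _ exz').
  by have := ler_norm r; rewrite /s /= ler_norml !ltr_norml; lra.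
apply: In_map_mem; rewrite mem_iota fcodim //=.
have [] := codimP (f z); lia.
Qed.

Lemma asdim_le_euclid : asdim_le E [set: 'rV[R]_n] n.
Proof.
rewrite -[X in asdim_le _ _ X]subn0; apply: cells_asdim_le => // s s0.
have k0 := kappa_gt0 R n.
(* With this unit, displacements of [2 * s] become [kappa]. *)
exists (2 * s / kappa R n), (fun x i => x ord0 i / (2 * s / kappa R n)); split=> //.
- by rewrite divr_gt0 // mulr_gt0.
- by move=> x i _; rewrite subrr normr0.
move=> x y _ _ xy i; rewrite -mulrBl normrM normfV.
have h : 0 < 2 * s / kappa R n by rewrite divr_gt0 // mulr_gt0.
rewrite (gtr0_norm h) ler_pdivrMr //.
by rewrite mulrC divfK ?gt_eqF.
Qed.
End UpperBound.

(** * Projection to the skeleton *)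

Section RadialProjection.
Variables (R : realType) (n : nat) (i0 : 'I_n).
Variables (c p : 'I_n -> R).
Hypothesis p_centered : forall i, `|p i - (c i + 2^-1)| <= 4^-1.
Implicit Types x y : 'I_n -> R.

Definition in_cube x := forall i, c i <= x i <= c i + 1.

Definition coord_gauge x i : R :=
  Num.max ((x i - p i) / (c i + 1 - p i)) ((p i - x i) / (p i - c i)).

(* Minkowski functional of the cube with respect to [p]. *)
Definition gauge x : R := coord_gauge x [arg max_(i > i0) coord_gauge x i]%O.

Definition radial_proj x i : R := p i + (x i - p i) / gauge x.

Lemma centered_bounds i : 4^-1 <= p i - c i <= 3 / 4 /\ 4^-1 <= c i + 1 - p i <= 3 / 4.
Proof. by have := p_centered i; rewrite ler_norml; lra. Qed.

(** The sublevel sets are intervals scaled about [p]; this turns bounds on quotients into linear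
    ones. *)
Lemma coord_gauge_le x i b :
  (coord_gauge x i <= b) = (p i - b * (p i - c i) <= x i <= p i + b * (c i + 1 - p i)).
Proof.
have [h1 h2] := centered_bounds i.
rewrite /coord_gauge ge_max !ler_pdivrMr; [|lra|lra].
by rewrite andbC lerBlDr lerBlDl; congr (_ && _); apply/idP/idP; lra.
Qed.

Lemma coord_gauge_ge0 x i : 0 <= coord_gauge x i.
Proof.
have [h1 h2] := centered_bounds i.
have := le_refl (coord_gauge x i); rewrite coord_gauge_le; nra.
Qed.

Lemma coord_gauge_norm x i : `|x i - p i| <= 3 / 4 * coord_gauge x i.
Proof.
have [h1 h2] := centered_bounds i; have := coord_gauge_ge0 x i.
have := le_refl (coord_gauge x i); rewrite coord_gauge_le ler_norml; nra.
Qed.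

(** The constant 4 is due to [p] being at distance at least [1/4] from every wall. *)
Lemma coord_gauge_lip x y i eta : `|x i - y i| <= eta ->
  coord_gauge x i <= coord_gauge y i + 4 * eta.
Proof.
move=> xy; have [h1 h2] := centered_bounds i.
have : 0 <= eta by exact: le_trans xy.
have := le_refl (coord_gauge y i); rewrite !coord_gauge_le; move: xy; rewrite ler_norml.
nra.
Qed.

Lemma gauge_ge x i : coord_gauge x i <= gauge x.
Proof. by rewrite /gauge; case: arg_maxP => // j _; apply. Qed.

Lemma gauge_attained x : exists i, gauge x = coord_gauge x i.
Proof. by eexists. Qed.

Lemma gauge_lip x y eta : (forall i, `|x i - y i| <= eta) ->
  `|gauge x - gauge y| <= 4 * eta.
Proof.
have half u v : (forall i, `|u i - v i| <= eta) -> gauge u <= gauge v + 4 * eta.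
  move=> uv; have [i ->] := gauge_attained u.
  by apply: le_trans (coord_gauge_lip (uv i)) _; rewrite lerD2r gauge_ge.
move=> xy; have h1 := half _ _ xy.
have h2 : gauge y <= gauge x + 4 * eta by apply: half => i; rewrite distrC.
by rewrite ler_norml; lra.
Qed.

Lemma gauge_lower x i : `|x i - p i| <= gauge x.
Proof.
have := coord_gauge_norm x i; have := gauge_ge x i; have := coord_gauge_ge0 x i; lra.
Qed.

Lemma radial_proj_in_cube x : 0 < gauge x -> in_cube (radial_proj x).
Proof.
move=> g0 i; have := gauge_ge x i; rewrite coord_gauge_le /radial_proj.
set g := gauge x in g0 *; move=> /andP[h1 h2].
have : - (p i - c i) <= (x i - p i) / g <= c i + 1 - p i.
  by rewrite ler_pdivrMr // ler_pdivlMr //; lra.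
lra.
Qed.

Lemma radial_proj_wall x : 0 < gauge x ->
  exists i, radial_proj x i = c i \/ radial_proj x i = c i + 1.
Proof.
move=> g0; have [i gi] := gauge_attained x; exists i; have [h1 h2] := centered_bounds i.
have g_neq0 : gauge x != 0 by rewrite gt_eqF.
rewrite /radial_proj; move: gi; rewrite /coord_gauge.
case: leP => _ gi; [left|right].
  have -> : x i - p i = - ((p i - c i) * gauge x).
    by rewrite gi mulrC divfK; [lra|apply: lt0r_neq0; lra].
  by rewrite mulNr mulfK //; lra.
have -> : x i - p i = (c i + 1 - p i) * gauge x.
  by rewrite gi mulrC divfK //; apply: lt0r_neq0; lra.
by rewrite mulfK //; lra.
Qed.

Lemma radial_proj_fixed x j : in_cube x -> x j = c j \/ x j = c j + 1 ->
  gauge x = 1 /\ radial_proj x =1 x.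
Proof.
move=> xin xj; have [h1 h2] := centered_bounds j.
have g1 : gauge x = 1.
  apply/eqP; rewrite eq_le; apply/andP; split.
    have [i ->] := gauge_attained x; rewrite coord_gauge_le; have := xin i; lra.
  apply: le_trans (gauge_ge x j); rewrite /coord_gauge le_max.
  by case: xj => ->; rewrite divff ?lexx ?orbT //; apply: lt0r_neq0; lra.
by split=> // i; rewrite /radial_proj g1 divr1; lra.
Qed.

(** Moving the point costs [eta], and changing the gauge costs [3/4 * (4 * eta)]; both are divided
    by the gauge of [x] alone, so [y] only has to differ from [p]. *)
Lemma radial_proj_lip x y rho eta : 0 < rho -> rho <= gauge x -> 0 < gauge y ->
  (forall i, `|x i - y i| <= eta) ->
  forall i, `|radial_proj x i - radial_proj y i| <= 4 * eta / rho.
Proof.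
move=> rho0 gx gy xy i; have gx0 := lt_le_trans rho0 gx.
have eta0 : 0 <= eta by exact: le_trans (xy i).
have -> : radial_proj x i - radial_proj y i =
    ((x i - y i) + (y i - p i) / gauge y * (gauge y - gauge x)) / gauge x.
  by rewrite /radial_proj; field; rewrite !gt_eqF.
rewrite normrM normfV (gtr0_norm gx0).
apply: ler_pM; rewrite ?invr_ge0 ?(ltW gx0) ?lef_pV2 ?posrE //.
have yb : `|(y i - p i) / gauge y| <= 3 / 4.
  rewrite normrM normfV (gtr0_norm gy) ler_pdivrMr //.
  by have := coord_gauge_norm y i; have := gauge_ge y i; lra.
apply: le_trans (ler_normD _ _) _; rewrite normrM.
have := gauge_lip xy; rewrite distrC => gl.
have : `|(y i - p i) / gauge y| * `|gauge y - gauge x| <= 3 / 4 * (4 * eta) by apply: ler_pM.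
have := xy i; lra.
Qed.
End RadialProjection.

Section SkeletonProjection.
Variables (R : realType) (n : nat) (i0 : 'I_n).
Variable P : ('I_n -> int) -> 'I_n -> R.
Hypothesis P_centered : forall q i, `|P q i - ((q i)%:~R + 2^-1)| <= 4^-1.
Variable rho : R.
Hypothesis rho_itv : 0 < rho <= 1.
Implicit Types x y : 'I_n -> R.

Definition cube_index x : 'I_n -> int := fun i => Num.floor (x i).
Definition corner x : 'I_n -> R := fun i => (cube_index x i)%:~R.
Definition off_hole x := exists i, rho <= `|x i - P (cube_index x) i|.
Definition skeleton_proj x : 'I_n -> R := radial_proj i0 (corner x) (P (cube_index x)) x.

Lemma in_corner_cube x : in_cube (corner x) x.
Proof. by move=> i; have := floor_itv (x i); rewrite /corner intrD; lra. Qed.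

Lemma off_hole_gauge x : off_hole x -> rho <= gauge i0 (corner x) (P (cube_index x)) x.
Proof.
by move=> [i xi]; apply: le_trans xi _; apply: gauge_lower => j; exact: P_centered.
Qed.

Lemma skeleton_proj_close x i : off_hole x -> `|skeleton_proj x i - x i| <= 1.
Proof.
move=> /off_hole_gauge hx; have [rho0 _] := andP rho_itv.
have := in_corner_cube x i.
have := @radial_proj_in_cube _ _ i0 _ _ (P_centered _) x (lt_le_trans rho0 hx) i.
by rewrite /skeleton_proj ler_norml; lra.
Qed.

Lemma skeleton_proj_int x : off_hole x -> exists j (z : int), skeleton_proj x j = z%:~R.
Proof.
move=> /off_hole_gauge hx; have [rho0 _] := andP rho_itv.
have [j [h|h]] := @radial_proj_wall _ _ i0 _ _ (P_centered _) x (lt_le_trans rho0 hx).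
  by exists j, (cube_index x j).
by exists j, (cube_index x j + 1); rewrite intrD.
Qed.

Definition clamp (c : 'I_n -> R) y i : R := Num.max (c i) (Num.min (y i) (c i + 1)).

Lemma clamp_cases c y i :
  [\/ y i < c i /\ clamp c y i = c i, c i <= y i <= c i + 1 /\ clamp c y i = y i |
      c i + 1 < y i /\ clamp c y i = c i + 1].
Proof.
rewrite /clamp; have [yc|cy] := leP (y i) (c i + 1).
  by have [h|h] := leP (c i) (y i); [constructor 2|constructor 1].
by have -> : Num.max (c i) (c i + 1) = c i + 1; [apply/max_r; lra|constructor 3].
Qed.

(* When [y] lies in another cube, clamping it to the cube of [x] yields a boundary point, which
   the projection fixes. *)
Lemma skeleton_proj_clamp x y eta : off_hole x -> cube_index x <> cube_index y ->
  (forall i, `|x i - y i| <= eta) ->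
  (forall i, `|skeleton_proj x i - clamp (corner x) y i| <= 4 * eta / rho) /\
  (forall i, `|x i - clamp (corner x) y i| <= eta).
Proof.
move=> /off_hole_gauge hx neq xy; have [rho0 _] := andP rho_itv.
have xw i : `|x i - clamp (corner x) y i| <= eta.
  have := in_corner_cube x i; have := xy i; rewrite !ler_norml.
  by case: (clamp_cases (corner x) y i) => -[? ->]; lra.
split=> //.
have [j neqj] : exists j, cube_index x j <> cube_index y j.
  by apply: contrapT => h; apply: neq; apply/funext => j; apply: contrapT => hj; apply: h; exists j.
have win : in_cube (corner x) (clamp (corner x) y).
  by move=> i; case: (clamp_cases (corner x) y i) => -[? ->]; lra.
have wj : clamp (corner x) y j = corner x j \/ clamp (corner x) y j = corner x j + 1.
  have out : y j < corner x j \/ corner x j + 1 <= y j.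
    have [h1|h1] := ltP (y j) (corner x j); [by left|right].
    rewrite leNgt; apply/negP => h2; apply: neqj; apply/esym/floor_def.
    by rewrite intrD h1 h2.
  case: (clamp_cases (corner x) y j) => -[yj ->]; [by left| |by right].
  by case: out => ?; [lra|right; lra].
have [g1 fixw] := radial_proj_fixed i0 (P_centered _) win wj.
move=> i; rewrite -[X in _ - X]fixw.
by apply: radial_proj_lip => //; rewrite g1.
Qed.

(** In a common cube the constant is 4. Otherwise the path through both clamped points costs
    [4 * eta / rho] at each end and [eta] for each of the three middle steps, and
    [eta <= eta / rho]. *)
Lemma skeleton_proj_lip x y eta : off_hole x -> off_hole y ->
  (forall i, `|x i - y i| <= eta) ->
  forall i, `|skeleton_proj x i - skeleton_proj y i| <= 11 * eta / rho.
Proof.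
move=> hx hy xy i; have [rho0 rho1] := andP rho_itv.
have eta0 : 0 <= eta by exact: le_trans (xy i).
have etar : eta <= eta / rho by rewrite ler_pdivlMr //; nra.
case: (pselect (cube_index x = cube_index y)) => [e|neq].
  have := @radial_proj_lip _ _ i0 _ _ (P_centered (cube_index x)) x y rho eta.
  have := off_hole_gauge hx; have := off_hole_gauge hy.
  rewrite /skeleton_proj /corner -e => gy gx /(_ rho0 gx (lt_le_trans rho0 gy) xy i).
  rewrite -!mulrA; move: etar; set a := eta / rho; lra.
have [h1 h2] := skeleton_proj_clamp hx neq xy.
have yx j : `|y j - x j| <= eta by rewrite distrC.
have [h3 h4] := skeleton_proj_clamp hy (nesym neq) yx.
have := h1 i; have := h2 i; have := h3 i; have := h4 i; have := xy i.
by rewrite -!mulrA; move: etar; set a := eta / rho; rewrite !ler_norml; lra.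
Qed.
End SkeletonProjection.

(** * Small sets have asymptotic dimension below [n] *)

Section Small.
Variables (R : realType) (n : nat).
Implicit Types (x y : 'rV[R]_n) (A L : set 'rV[R]_n).
Local Notation dist := (@euclid_dist R n).
Local Notation E := (metric_coarse dist).

(* Smallness is tested on the large set [A `|` ~` B(A, r)]. *)
Lemma small_holes A (rho : R) : small E A -> 0 < rho ->
  exists K : R, 0 < K /\ forall y, exists p : 'rV[R]_n, (forall i, `|p ord0 i - y ord0 i| <= K) /\
    forall a, A a -> exists i, rho <= `|a ord0 i - p ord0 i|.
Proof.
move=> smallA rho0; pose r := n%:R * rho + 1.
have r0 : 0 < r by rewrite /r; have := ler0n R n; nra.
pose far := [set y | forall a, A a -> r <= dist a y].
have [|K [K0 dense]] := (largeP _).1 (smallA (A `|` far) _).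
  apply/largeP; exists r; split=> // y.
  have [[a [Aa ay]]|h] := pselect (exists a, A a /\ dist a y < r).
    by exists a => //; left.
  exists y; last by rewrite distxx.
  by right => a Aa; rewrite leNgt; apply/negP => ay; apply: h; exists a.
(* A point of the large set outside [A] must lie in [far], and it serves as the hole near [y]. *)
exists K; split=> // y; have [p [[//|farp] _] py] := dense y; exists p; split.
  by move=> i; apply: le_trans (coord_le_dist _ _ i) (ltW py).
move=> a Aa; apply: contrapT => h; have := farp a Aa; rewrite leNgt => /negP; apply.
apply: (@le_lt_trans _ _ (n%:R * rho)); last by rewrite /r; lra.
apply: dist_le_coord; first exact: ltW.
by move=> i; rewrite leNgt; apply/negP => /ltW hi; apply: h; exists i.
Qed.

Lemma small_asdim_le A : (0 < n)%N -> small E A -> asdim_le E A (n - 1).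
Proof.
move=> n0 smallA; apply: cells_asdim_le => // s s0.
have k0 := kappa_gt0 R n.
(* Chosen so that the Lipschitz constant [11 / rho] takes [2 * s] to [kappa]. *)
pose rho := 22 * s / kappa R n.
have rho0 : 0 < rho by rewrite divr_gt0 // mulr_gt0.
have [K [K0 holes]] := small_holes smallA rho0.
(* Then [K / D <= 1/4], which keeps the holes near the cube centres, and [rho / D <= 1]. *)
pose D := 4 * K + rho.
have D0 : 0 < D by rewrite /D; lra.
have [h hP] := choice holes.
pose P (q : 'I_n -> int) (i : 'I_n) : R := h (\row_j (((q j)%:~R + 2^-1) * D)) ord0 i / D.
have Pc q i : `|P q i - ((q i)%:~R + 2^-1)| <= 4^-1.
  have := (hP (\row_j (((q j)%:~R + 2^-1) * D))).1 i; rewrite mxE => hi.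
  have -> : P q i - ((q i)%:~R + 2^-1) =
      (h (\row_j (((q j)%:~R + 2^-1) * D)) ord0 i - ((q i)%:~R + 2^-1) * D) / D.
    by rewrite mulrBl mulfK // gt_eqF.
  by rewrite normrM normfV (gtr0_norm D0) ler_pdivrMr //; rewrite /D; lra.
have rhoD : 0 < rho / D <= 1 by rewrite divr_gt0 //= ler_pdivrMr // /D; lra.
pose scale (x : 'rV[R]_n) (i : 'I_n) : R := x ord0 i / D.
have off x : A x -> off_hole P (rho / D) (scale x).
  move=> Ax; have [i hi] := (hP (\row_j (((cube_index (scale x) j)%:~R + 2^-1) * D))).2 x Ax.
  exists i; rewrite /P /scale -mulrBl normrM normfV (gtr0_norm D0).
  by rewrite ler_wpM2r // invr_ge0 ltW.
exists D, (fun x => skeleton_proj (Ordinal n0) P (scale x)); split=> //.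
- by move=> x i Ax; apply: (skeleton_proj_close _ Pc rhoD); exact: off.
- move=> x y Ax Ay xy i.
  have xyD j : `|scale x j - scale y j| <= 2 * s / D.
    by rewrite -mulrBl normrM normfV (gtr0_norm D0) ler_wpM2r // invr_ge0 ltW.
  have := skeleton_proj_lip (Ordinal n0) Pc rhoD (off x Ax) (off y Ay) xyD i.
  suff -> : 11 * (2 * s / D) / (rho / D) = kappa R n by [].
  by rewrite /rho; field; rewrite !gt_eqF.
move=> x Ax; have [j [z jz]] := skeleton_proj_int (Ordinal n0) Pc rhoD (off x Ax).
exact: codim_gt0 jz.
Qed.
End Small.

(** * Comparison of the two ideals *)

Lemma asdim_Some_le (T : Type) (E : entourages T) (A : set T) m :
  asdim E A = Some m -> asdim_le E A m.
Proof.
rewrite /asdim; case: pselect => // h [<-]; case: ex_minnP => k /asboolP //.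
Qed.

Lemma asdim_le_Some (T : Type) (E : entourages T) (A : set T) m :
  asdim_le E A m -> exists2 k, asdim E A = Some k & (k <= m)%N.
Proof.
move=> hm; rewrite /asdim; case: pselect => [h|]; last by case; exists m.
by eexists; first reflexivity; case: ex_minnP => k _; apply; apply/asboolP.
Qed.

Theorem theorem1p2 (R : realType) (n : nat) (hn : (1 <= n)%N)
    (A : set 'rV[R]_n) :
  small (metric_coarse (@euclid_dist R n)) A <->
  olt (asdim (metric_coarse (@euclid_dist R n)) A)
      (asdim (metric_coarse (@euclid_dist R n)) setT).
Proof.
have [d dT dn] := asdim_le_Some (@asdim_le_euclid R n).
rewrite dT; split=> [/(small_asdim_le hn)/asdim_le_Some[k -> kn] /=|].
  (* If [d < n], the whole space would be small and its empty complement large. *)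
  have : (n <= d)%N; last by lia.
  rewrite leqNgt; apply/negP => /asdim_lt_small/(_ (asdim_Some_le dT)) smallT.
  have /smallT/largeP[r [_ /(_ 0)[a []]]] // : large (metric_coarse (@euclid_dist R n)) setT.
  by apply/largeP; exists 1; split=> // y; exists y; rewrite ?distxx.
case: asdim (@asdim_Some_le _ (metric_coarse (@euclid_dist R n)) A) => //= k /(_ _ erefl) Ak kd.
by apply: asdim_lt_small Ak; lia.
Qed.
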